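(* Let $R \to S$ be an Ohm-Rush algebra. Then the following are equivalent: (1) $R \to S$ is a weak content algebra. (2) $R \to S$ is residually McCoy for prime ideals. (3) $R \to S$ is residually McCoy for radical ideals. Hence, a residually McCoy algebra is always a weak content algebra.
   Context: All rings are commutative with identity. Let $R \to S$ be a ring homomorphism. For $f \in S$, the content $c(f) = c_{SR}(f)$ is the intersection of all ideals $I$ of $R$ such that $f \in IS$. The algebra $R \to S$ is called Ohm-Rush if $f \in c(f)S$ for every $f \in S$ (i.e. for each $f$ there is a smallest ideal $I$ of $R$ with $f\in IS$). An Ohm-Rush algebra is a weak content algebra if for all $f,g\in S$ the ideals $c(fg)$ and $c(f)c(g)$ of $R$ have the same radical. An Ohm-Rush algebra $R \to S$ is McCoy if whenever $f,g \in S$ with $fg=0$ and $g \neq 0$, there is some nonzero $r \in R$ with $r\,c(f) = 0$. It is known that if $R \to S$ is Ohm-Rush and $I$ is an ideal of $R$, then $R/I \to S/IS$ is Ohm-Rush. For a set $\mathcal{I}$ of ideals of $R$, an Ohm-Rush algebra $R \to S$ is residually McCoy for $\mathcal{I}$ if for every $I \in \mathcal{I}$ the algebra $R/I \to S/IS$ is McCoy (where content is computed with respect to $R/I \to S/IS$). ''Residually McCoy for prime (resp. radical) ideals'' means that $\mathcal{I}$ is the set of all prime (resp. radical) ideals of $R$; ''residually McCoy'' means that $\mathcal{I}$ is the set of all ideals of $R$. *)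

(* Defs.v *)
From HB Require Import structures.
From mathcomp Require Import all_boot all_algebra.
From mathcomp Require Import generic_quotient ring_quotient.
From mathcomp Require Import boolp classical_sets.

Set Implicit Arguments.
Unset Strict Implicit.
Unset Printing Implicit Defensive.

Import GRing.Theory.

Local Open Scope ring_scope.
Local Open Scope classical_set_scope.
Local Open Scope quotient_scope.

(* Unlike [idealr] of ring_quotient, the unit ideal is allowed, and so is the
   zero ring ([comPzRingType]): S / IS may be zero even when I is prime.
   Boolean predicates cover all ideals, by the classical axioms of [boolp]. *)
HB.mixin Record isMulAbsorbing (R : comPzRingType) (I : R -> bool) := {
  ideal_absorb : forall a, {in I, forall x, a * x \in I}
}.

#[short(type="ideal")]
HB.structure Definition Ideal (R : comPzRingType) :=
  {I of GRing.ZmodClosed R I & isMulAbsorbing R I}.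

Section IdealOperations.
Variable R : comPzRingType.
Implicit Types (A : set R) (I J : ideal R) (P : set (ideal R)).

Definition bigcap_pred P : {pred R} :=
  fun x => `[< forall I, P I -> x \in I >].

Fact bigcap_zmod_closed P : zmod_closed (bigcap_pred P).
Proof.
split=> [|x y /asboolP Px /asboolP Py]; apply/asboolP=> I PI.
  exact: rpred0.
by apply: rpredB; [apply: Px | apply: Py].
Qed.

Fact bigcap_absorb P a : {in bigcap_pred P, forall x, a * x \in bigcap_pred P}.
Proof.
move=> x /asboolP Px; apply/asboolP=> I PI.
exact: ideal_absorb (Px I PI).
Qed.

HB.instance Definition _ P :=
  GRing.isZmodClosed.Build R (bigcap_pred P) (bigcap_zmod_closed P).
HB.instance Definition _ P :=
  isMulAbsorbing.Build R (bigcap_pred P) (@bigcap_absorb P).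

Definition ideal_bigcap P : ideal R := bigcap_pred P.

Definition ideal_gen A : ideal R :=
  ideal_bigcap [set I | forall x, A x -> x \in I].

Definition ideal_mul I J : ideal R :=
  ideal_gen [set z | exists x y, [/\ x \in I, y \in J & z = x * y]].

Definition radical I : set R :=
  [set x | exists2 n, (0 < n)%N & x ^+ n \in I].

Definition is_radical I : Prop := radical I = [set x | x \in I].

Definition is_prime I : Prop :=
  1 \notin I /\ (forall x y, x * y \in I -> x \in I \/ y \in I).

End IdealOperations.

Section QuotientRing.
Variables (R : comPzRingType) (I : ideal R).

(* ring_quotient equips the additive quotient with a ring structure only for
   proper ideals of nontrivial rings, hence the instances below. *)
Definition ring_quot := Quotient.quot I.

HB.instance Definition _ := GRing.Zmodule.on ring_quot.

Definition quot_proj (x : R) : ring_quot := \pi_(Quotient.quot I) x.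
Definition quot_repr (x : ring_quot) : R := repr (x : Quotient.quot I).

Definition quot_one : ring_quot := quot_proj 1.
Definition quot_mul (x y : ring_quot) : ring_quot :=
  quot_proj (quot_repr x * quot_repr y).

Lemma quot_reprK x : quot_proj (quot_repr x) = x.
Proof. exact: reprK. Qed.

Lemma quot_proj_eq x y : (quot_proj x == quot_proj y) = (x - y \in I).
Proof. by rewrite /quot_proj -Quotient.idealrBE. Qed.

Lemma quot_projB : zmod_morphism quot_proj.
Proof. by move=> x y; apply: (raddfB \pi_(Quotient.quot I)). Qed.

Lemma quot_projD : {morph quot_proj : x y / x + y}.
Proof. by move=> x y; apply: (raddfD \pi_(Quotient.quot I)). Qed.

Lemma quot_projM : {morph quot_proj : x y / x * y >-> quot_mul x y}.
Proof.
move=> x y; apply/eqP; rewrite quot_proj_eq.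
set x' := quot_repr _; set y' := quot_repr _.
have Ix : x - x' \in I by rewrite -quot_proj_eq quot_reprK.
have Iy : y - y' \in I by rewrite -quot_proj_eq quot_reprK.
rewrite -[x * y](subrK (x * y')) -mulrBr -addrA -mulrBl.
by apply: rpredD; [|rewrite mulrC]; apply: ideal_absorb.
Qed.

Fact quot_mulA : associative quot_mul.
Proof.
move=> x y z; rewrite -[x]quot_reprK -[y]quot_reprK -[z]quot_reprK.
by rewrite -!quot_projM mulrA.
Qed.

Fact quot_mulC : commutative quot_mul.
Proof. by move=> x y; rewrite /quot_mul mulrC. Qed.

Fact quot_mul1 : left_id quot_one quot_mul.
Proof. by move=> x; rewrite -[x]quot_reprK -quot_projM mul1r. Qed.

Fact quot_mulD : left_distributive quot_mul +%R.
Proof.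
move=> x y z; rewrite -[x]quot_reprK -[y]quot_reprK -[z]quot_reprK.
by rewrite -quot_projD -!quot_projM mulrDl quot_projD.
Qed.

HB.instance Definition _ := GRing.Zmodule_isComPzRing.Build ring_quot
  quot_mulA quot_mulC quot_mul1 quot_mulD.

Fact quot_proj_monoid : monoid_morphism quot_proj.
Proof. by split=> // x y; rewrite quot_projM. Qed.

HB.instance Definition _ :=
  GRing.isZmodMorphism.Build R ring_quot quot_proj quot_projB.
HB.instance Definition _ :=
  GRing.isMonoidMorphism.Build R ring_quot quot_proj quot_proj_monoid.

End QuotientRing.

Section Extension.
Variables (R S : comPzRingType) (phi : {rmorphism R -> S}).

(* The ideal IS. *)
Definition ideal_ext (I : ideal R) : ideal S :=
  ideal_gen [set y | exists2 x, x \in I & y = phi x].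

(* The induced map R / I -> S / IS; it does not depend on the choice of
   representatives, see [quot_mapE]. *)
Definition quot_map (I : ideal R) (x : ring_quot I) : ring_quot (ideal_ext I) :=
  quot_proj (ideal_ext I) (phi (quot_repr x)).

Lemma quot_mapE I x :
  quot_map (quot_proj I x) = quot_proj (ideal_ext I) (phi x).
Proof.
apply/eqP; rewrite quot_proj_eq -rmorphB; apply/asboolP=> J; apply.
by exists (quot_repr (quot_proj I x) - x); rewrite // -quot_proj_eq quot_reprK.
Qed.

Fact quot_map_zmod I : zmod_morphism (@quot_map I).
Proof.
move=> x y; rewrite -[x]quot_reprK -[y]quot_reprK -rmorphB.
by rewrite !quot_mapE !rmorphB.
Qed.

Fact quot_map_monoid I : monoid_morphism (@quot_map I).
Proof.
split=> [|x y]; first by rewrite -(rmorph1 (quot_proj I)) quot_mapE !rmorph1.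
rewrite -[x]quot_reprK -[y]quot_reprK -rmorphM.
by rewrite !quot_mapE !rmorphM.
Qed.

HB.instance Definition _ I := GRing.isZmodMorphism.Build
  (ring_quot I) (ring_quot (ideal_ext I)) (@quot_map I) (@quot_map_zmod I).
HB.instance Definition _ I := GRing.isMonoidMorphism.Build
  (ring_quot I) (ring_quot (ideal_ext I)) (@quot_map I) (@quot_map_monoid I).

Definition quot_morph (I : ideal R) :
  {rmorphism ring_quot I -> ring_quot (ideal_ext I)} := @quot_map I.

End Extension.

Section OhmRush.
Variables (R S : comPzRingType) (phi : {rmorphism R -> S}).

Definition content (f : S) : ideal R :=
  ideal_bigcap [set I | f \in ideal_ext phi I].

Definition ohm_rush : Prop := forall f : S, f \in ideal_ext phi (content f).

Definition weak_content : Prop :=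
  ohm_rush /\
  forall f g : S,
    radical (content (f * g)) = radical (ideal_mul (content f) (content g)).

Definition mccoy : Prop :=
  ohm_rush /\
  forall f g : S, f * g = 0 -> g != 0 ->
    exists2 r : R, r != 0 & forall a, a \in content f -> r * a = 0.

End OhmRush.

Definition residually_mccoy_for (R S : comPzRingType)
    (phi : {rmorphism R -> S}) (P : set (ideal R)) : Prop :=
  ohm_rush phi /\ forall I, P I -> mccoy (quot_morph phi I).

Definition residually_mccoy (R S : comPzRingType)
    (phi : {rmorphism R -> S}) : Prop :=
  residually_mccoy_for phi [set: ideal R].

(* Main.v *)
Require Import Defs.
From HB Require Import structures.
From mathcomp Require Import all_boot all_algebra.
From mathcomp Require Import boolp classical_sets.

(** For an ideal [J] of [R], [f \in JS] iff [c(f) <= J]; the inclusion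
    [c(fg) <= c(f)c(g)] always holds.  Hence [R/J -> S/JS] is McCoy iff,
    whenever [J] contains [c(fg)] but not [c(g)], there is some [r \notin J]
    with [r c(f) <= J].  If [R -> S] is a weak content algebra and [J] is radical,
    then [c(f)c(g) <= J], so any [r \in c(g)] outside [J] will do.  Conversely,
    if [J] is prime then [r c(f) <= J] forces [c(f) <= J], so that every prime
    containing [c(fg)] contains [c(f)] or [c(g)]; since the radical of [c(fg)]
    is an intersection of primes, it contains [c(f)c(g)]. *)

Set Implicit Arguments.
Unset Strict Implicit.
Unset Printing Implicit Defensive.

Import GRing.Theory.

Local Open Scope ring_scope.
Local Open Scope classical_set_scope.

Definition ideal_of_pred (R : comPzRingType) (p : R -> bool)
    (p_zmod : zmod_closed p)
    (p_absorb : forall a, {in p, forall x, a * x \in p}) : ideal R :=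
  HB.pack p (GRing.isZmodClosed.Build R p p_zmod)
    (isMulAbsorbing.Build R p p_absorb).

(** * Colon ideals, Zorn's lemma and primes *)

Section Ideals.
Variable R : comPzRingType.
Implicit Types (A : set R) (I J P : ideal R).

Lemma ideal_absorbr I a x : x \in I -> x * a \in I.
Proof. by move=> Ix; rewrite mulrC; apply: ideal_absorb. Qed.

Lemma ideal_gen_mem A x : A x -> x \in ideal_gen A.
Proof. by move=> Ax; apply/asboolP=> I; apply. Qed.

Lemma ideal_gen_min A I :
  (forall x, A x -> x \in I) -> {subset ideal_gen A <= I}.
Proof. by move=> AI x /asboolP; apply. Qed.

Lemma ideal_mul_mem I J x y : x \in I -> y \in J -> x * y \in ideal_mul I J.
Proof. by move=> Ix Jy; apply: ideal_gen_mem; exists x, y. Qed.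

(** The colon ideal [(I : a)]: it makes [a * x \in I] a membership in an ideal, to be checked on
    generators only. *)
Definition colon_pred I (a : R) : R -> bool := fun x => a * x \in I.

Lemma in_colon_pred I a x : (x \in colon_pred I a) = (a * x \in I).
Proof. by []. Qed.

Fact colon_zmod_closed I a : zmod_closed (colon_pred I a).
Proof.
split=> [|x y]; rewrite !in_colon_pred; first by rewrite mulr0 rpred0.
by move=> Ix Iy; rewrite mulrBr; apply: rpredB.
Qed.

Fact colon_absorb I a b :
  {in colon_pred I a, forall x, b * x \in colon_pred I a}.
Proof.
by move=> x; rewrite !in_colon_pred mulrCA => Ix; apply: ideal_absorb.
Qed.

Definition colon I a : ideal R :=
  ideal_of_pred (colon_zmod_closed I a) (@colon_absorb I a).

Lemma in_colon I a x : (x \in colon I a) = (a * x \in I).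
Proof. by []. Qed.

Lemma radical_subset I J :
  {subset I <= J} -> radical I `<=` radical J.
Proof. by move=> IJ x [n n0 Ix]; exists n => //; apply: IJ. Qed.

Lemma prime_exp P x n : is_prime P -> x ^+ n \in P -> x \in P.
Proof.
move=> [P1 Pm]; elim: n => [|n IHn]; first by rewrite expr0 (negbTE P1).
by rewrite exprS => /Pm[].
Qed.

Lemma prime_radical P : is_prime P -> is_radical P.
Proof.
move=> Pp; apply/seteqP; split=> x /=; first by case=> n _ /(prime_exp Pp).
by move=> Px; exists 1%N.
Qed.

(** Two elements of the union lie in a common member of the chain, hence so does their difference;
    nonemptiness supplies 0. *)
Lemma chain_union_ideal (C : set (ideal R)) : C !=set0 ->
    (forall I J, C I -> C J -> {subset I <= J} \/ {subset J <= I}) ->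
  exists U : ideal R, forall x, x \in U <-> exists2 I, C I & x \in I.
Proof.
move=> [I0 CI0] Ctot.
pose p : R -> bool := fun x => `[< exists2 I, C I & x \in I >].
have p_zmod : zmod_closed p.
  split=> [|x y /asboolP[I CI Ix] /asboolP[J CJ Jy]].
    by apply/asboolP; exists I0 => //; apply: rpred0.
  apply/asboolP; case: (Ctot I J CI CJ) => sub.
    by exists J => //; apply: rpredB => //; apply: sub.
  by exists I => //; apply: rpredB => //; apply: sub.
have p_absorb a : {in p, forall x, a * x \in p}.
  move=> x /asboolP[I CI Ix]; apply/asboolP; exists I => //.
  exact: ideal_absorb.
exists (ideal_of_pred p_zmod p_absorb) => x.
by split=> [/asboolP|?] //; apply/asboolP.
Qed.

(** If [a] and [b] are both outside [P], maximality makes [P + (a)] and [P + (b)] meet [X], in [x]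
    and [y] say. Then [x * y] is in [X] and, since [a * b \in P], also in [P]. *)
Lemma maximal_avoiding_prime (X : set R) P : X 1 ->
    (forall x y, X x -> X y -> X (x * y)) -> (forall x, X x -> x \notin P) ->
    (forall J, {subset P <= J} -> (forall x, X x -> x \notin J) ->
      {subset J <= P}) ->
  is_prime P.
Proof.
move=> X1 XM XP Pmax; split=> [|a b Pab]; first exact: XP.
have meet c : c \notin P ->
    exists2 x, X x & x \in ideal_gen [set z | z \in P \/ z = c].
  move=> Pc; apply: contrapT => disj; move: Pc; apply/negP; rewrite negbK.
  apply: (Pmax (ideal_gen [set z | z \in P \/ z = c])).
  - by move=> z Pz; apply: ideal_gen_mem; left.
  - by move=> x Xx; apply/negP => gx; apply: disj; exists x.
  - by apply: ideal_gen_mem; right.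
apply: contrapT => /not_orP[/negP/meet[x Xx gx] /negP/meet[y Xy gy]].
(* Multiplication by [b] sends [P] and [a] into [P], hence all of [P + (a)]. *)
have bx : b * x \in P.
  rewrite -in_colon; apply: ideal_gen_min gx => z [Pz|->]; rewrite in_colon.
    exact: ideal_absorb.
  by rewrite mulrC.
have xy : x * y \in P.
  rewrite -in_colon; apply: ideal_gen_min gy => z [Pz|->]; rewrite in_colon.
    exact: ideal_absorb.
  by rewrite mulrC.
by have /negP := XP _ (XM _ _ Xx Xy).
Qed.

Lemma exists_prime_avoiding (X : set R) I : X 1 ->
    (forall x y, X x -> X y -> X (x * y)) -> (forall x, X x -> x \notin I) ->
  exists P, [/\ is_prime P, {subset I <= P} & forall x, X x -> x \notin P].
Proof.
move=> X1 XM XI.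
pose good J := {subset I <= J} /\ (forall x, X x -> x \notin J).
pose T := {J : ideal R | good J}.
pose le (J K : T) := `[< {subset sval J <= sval K} >].
have t0 : T by exists I; split.
have [|||[P [IP XP]] Pmax] := @ZL_preorder T t0 le.
- by move=> J; apply/asboolP.
- move=> J K L /asboolP JK /asboolP KL.
  by apply/asboolP => x /JK /KL.
(* An empty union is not an ideal, so the empty chain is bounded by [I] itself. *)
- move=> A Atot; have [[J0 AJ0]|A0] := pselect (A !=set0); last first.
    by exists t0 => J AJ; case: A0; exists J.
  have [||U UE] := @chain_union_ideal [set sval J | J in A].
  + by exists (sval J0); exists J0.
  + move=> _ _ [J AJ <-] [K AK <-].
    by case: (Atot J K AJ AK) => /asboolP; [left|right].
  + have Ugood : good U.
      split=> [x Ix|x Xx].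
        apply/UE; exists (sval J0); first by exists J0.
        exact: (proj1 (svalP J0)).
      apply/negP => /UE[_ [J _ <-]]; apply/negP.
      exact: (proj2 (svalP J)).
    exists (exist _ U Ugood) => J AJ; apply/asboolP => x Jx.
    by apply/UE; exists (sval J) => //; exists J.
- exists P; split=> //; apply: (maximal_avoiding_prime X1 XM XP) => J PJ XJ.
  have Jgood : good J by split=> // x /IP /PJ.
  apply/asboolP; apply: (Pmax (exist _ J Jgood)).
  exact/asboolP.
Qed.

(** If no power of [x] lies in [I], some prime above [I] avoids all powers of [x], in particular
    [x]. *)
Lemma mem_radical_primes I x :
  (forall P, is_prime P -> {subset I <= P} -> x \in P) -> radical I x.
Proof.
move=> xP; apply: contrapT => nrad.
have [|||P [Pp IP XP]] := @exists_prime_avoiding (range (GRing.exp x)) I.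
- by exists 0%N.
- by move=> _ _ [m _ <-] [n _ <-]; exists (m + n)%N; rewrite ?exprD.
- move=> _ [n _ <-]; apply/negP => Ixn; apply: nrad.
  (* [radical] asks for a positive exponent, while [n] may be 0. *)
  by exists n.+1 => //; rewrite exprS; apply: ideal_absorb.
- have /negP[] : x \notin P by apply: XP; exists 1%N.
  exact: xP.
Qed.

End Ideals.

(** * Extended ideals and content *)

Section Morphisms.
Variables (R S : comPzRingType) (phi : {rmorphism R -> S}).

Definition ideal_preim_pred (J : ideal S) : R -> bool := fun x => phi x \in J.

Lemma in_ideal_preim_pred J x : (x \in ideal_preim_pred J) = (phi x \in J).
Proof. by []. Qed.

Fact ideal_preim_zmod_closed J : zmod_closed (ideal_preim_pred J).
Proof.
split=> [|x y]; rewrite !in_ideal_preim_pred; first by rewrite rmorph0 rpred0.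
by move=> Jx Jy; rewrite rmorphB; apply: rpredB.
Qed.

Fact ideal_preim_absorb J a :
  {in ideal_preim_pred J, forall x, a * x \in ideal_preim_pred J}.
Proof.
by move=> x; rewrite !in_ideal_preim_pred rmorphM; apply: ideal_absorb.
Qed.

Definition ideal_preim (J : ideal S) : ideal R :=
  ideal_of_pred (ideal_preim_zmod_closed J) (@ideal_preim_absorb J).

Lemma in_ideal_preim J x : (x \in ideal_preim J) = (phi x \in J).
Proof. by []. Qed.

Lemma ideal_ext_mem (I : ideal R) x : x \in I -> phi x \in ideal_ext phi I.
Proof. by move=> Ix; apply: ideal_gen_mem; exists x. Qed.

Lemma ideal_ext_min (I : ideal R) (J : ideal S) :
  (forall x, x \in I -> phi x \in J) -> {subset ideal_ext phi I <= J}.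
Proof. by move=> IJ; apply: ideal_gen_min => _ [x Ix ->]; apply: IJ. Qed.

(** Two passages to a colon ideal, one per factor, reduce the claim to images of elements of [I] and
    [J]. *)
Lemma ideal_ext_mul (I J : ideal R) f g :
    f \in ideal_ext phi I -> g \in ideal_ext phi J ->
  f * g \in ideal_ext phi (ideal_mul I J).
Proof.
move=> If Jg; rewrite mulrC -in_colon.
apply: ideal_ext_min If => x Ix; rewrite in_colon mulrC -in_colon.
apply: ideal_ext_min Jg => y Jy; rewrite in_colon -rmorphM.
by apply: ideal_ext_mem; apply: ideal_mul_mem.
Qed.

Lemma content_min (I : ideal R) f :
  f \in ideal_ext phi I -> {subset content phi f <= I}.
Proof. by move=> If x /asboolP; apply. Qed.

(** Backwards, Ohm-Rush puts [f] in the extension of its content, which lies in that of [I]. *)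
Lemma ohm_rush_ext (I : ideal R) f : ohm_rush phi ->
  (f \in ideal_ext phi I) <-> {subset content phi f <= I}.
Proof.
move=> OR; split=> [|cI]; first exact: content_min.
by apply: ideal_ext_min (OR f) => x /cI; apply: ideal_ext_mem.
Qed.

Lemma content_mul f g : ohm_rush phi ->
  {subset content phi (f * g) <= ideal_mul (content phi f) (content phi g)}.
Proof. by move=> OR; apply: content_min; apply: ideal_ext_mul. Qed.

End Morphisms.

(** * Content and the McCoy property modulo an ideal *)

Section QuotientImage.
Variables (R : comPzRingType) (I K : ideal R).

Definition quot_image_pred : ring_quot I -> bool :=
  fun z => `[< exists2 x, x \in K & z = quot_proj I x >].

Fact quot_image_zmod_closed : zmod_closed quot_image_pred.
Proof.
split=> [|_ _ /asboolP[x Kx ->] /asboolP[y Ky ->]]; apply/asboolP.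
  by exists 0; rewrite ?rpred0 ?rmorph0.
by exists (x - y); rewrite ?rmorphB // rpredB.
Qed.

Fact quot_image_absorb a :
  {in quot_image_pred, forall z, a * z \in quot_image_pred}.
Proof.
move=> _ /asboolP[x Kx ->]; apply/asboolP; exists (quot_repr a * x).
  exact: ideal_absorb.
by rewrite rmorphM /= quot_reprK.
Qed.

Definition quot_image : ideal (ring_quot I) :=
  ideal_of_pred quot_image_zmod_closed quot_image_absorb.

(** Representatives of one class differ by an element of [I], hence of [K]. *)
Lemma quot_imageP x :
  {subset I <= K} -> quot_proj I x \in quot_image -> x \in K.
Proof.
move=> IK /asboolP[y Ky /eqP]; rewrite quot_proj_eq => /IK Kxy.
by rewrite -[x](subrK y) rpredD.
Qed.

End QuotientImage.

Section QuotientContent.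
Variables (R S : comPzRingType) (phi : {rmorphism R -> S}) (I : ideal R).

Lemma quot_proj_eq0 (T : comPzRingType) (J : ideal T) x :
  (quot_proj J x == 0) = (x \in J).
Proof. by rewrite -(rmorph0 (quot_proj J)) quot_proj_eq subr0. Qed.

Lemma ideal_ext_quot (J : ideal (ring_quot I)) f :
  (quot_proj (ideal_ext phi I) f \in ideal_ext (quot_morph phi I) J) <->
  (f \in ideal_ext phi (ideal_preim (quot_proj I) J)).
Proof.
split=> [Jf|].
  set K := ideal_ext _ _.
  (* The preimage of [J] contains [I], so membership in [K] can be tested on classes modulo the
     extension of [I]. *)
  have IK : {subset ideal_ext phi I <= K}.
    apply: ideal_ext_min => x Ix; apply: ideal_ext_mem.
    rewrite in_ideal_preim /=; move: Ix; rewrite -quot_proj_eq0 => /eqP->.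
    exact: rpred0.
  apply: (quot_imageP IK); apply: ideal_ext_min Jf => x Jx; apply/asboolP.
  exists (phi (quot_repr x)) => //.
  by apply: ideal_ext_mem; rewrite in_ideal_preim /= quot_reprK.
rewrite -in_ideal_preim; apply: ideal_ext_min => x; rewrite !in_ideal_preim.
by rewrite /= -quot_mapE; apply: (ideal_ext_mem (quot_morph phi I)).
Qed.

(** An ideal of [R / I] whose extension contains the class of [f] pulls back to one whose extension
    contains [f]. *)
Lemma content_quot f x : x \in content phi f ->
  quot_proj I x \in content (quot_morph phi I) (quot_proj _ f).
Proof.
move=> cx; apply/asboolP => J /ideal_ext_quot /content_min; exact.
Qed.

Lemma ohm_rush_quot : ohm_rush phi -> ohm_rush (quot_morph phi I).
Proof.
move=> OR f; rewrite -[f]quot_reprK; apply/ideal_ext_quot.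
apply/ohm_rush_ext => // x; exact: content_quot.
Qed.

(** This restates the McCoy property of the quotient with content computed over [R]. *)
Lemma mccoy_quotP : ohm_rush phi ->
  mccoy (quot_morph phi I) <->
  forall f g, f * g \in ideal_ext phi I -> g \notin ideal_ext phi I ->
    exists2 r, r \notin I & forall a, a \in content phi f -> r * a \in I.
Proof.
move=> OR; split=> [[_ mc] f g fg g0|mc].
  have [||r r0 rf] := mc (quot_proj _ f) (quot_proj _ g).
  - by rewrite -rmorphM; apply/eqP; rewrite quot_proj_eq0.
  - by rewrite quot_proj_eq0.
  exists (quot_repr r); first by rewrite -quot_proj_eq0 quot_reprK.
  move=> a /content_quot /rf ra.
  by rewrite -quot_proj_eq0 rmorphM /= quot_reprK ra.
split=> [|f g fg g0]; first exact: ohm_rush_quot.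
have [||r r0 rf] := mc (quot_repr f) (quot_repr g).
- by rewrite -quot_proj_eq0 rmorphM /= !quot_reprK fg.
- by rewrite -quot_proj_eq0 quot_reprK.
exists (quot_proj I r); first by rewrite quot_proj_eq0.
(* The zero ideal of [R / I]; its colon by the class of [r] is the annihilator that must contain the
   content. *)
pose z : ideal (ring_quot I) := ideal_gen set0.
have z0 a : a \in z -> a = 0.
  move=> az; rewrite -[a]quot_reprK; apply/eqP; rewrite quot_proj_eq0.
  apply: (quot_imageP (I := I)) => //; rewrite quot_reprK.
  exact: ideal_gen_min az.
move=> a ca; apply: z0; rewrite -in_colon; apply: content_min ca.
(* It suffices that the preimage of this annihilator contains the content of a representative of
   [f]. *)
rewrite -[f]quot_reprK; apply/ideal_ext_quot.
apply/ohm_rush_ext => // x /rf; rewrite in_ideal_preim in_colon -rmorphM /=.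
by rewrite -quot_proj_eq0 => /eqP->; apply: rpred0.
Qed.

End QuotientContent.

(** * The implications between the three conditions *)

Section WeakContent.
Variables (R S : comPzRingType) (phi : {rmorphism R -> S}).

Lemma weak_content_radical :
  weak_content phi -> residually_mccoy_for phi (@is_radical R).
Proof.
move=> [OR wc]; split=> // I Irad; apply/mccoy_quotP => // f g fg g0.
have [r cr Ir] : exists2 r, r \in content phi g & r \notin I.
  apply: contrapT => nor; move/negP: g0; apply; apply/ohm_rush_ext => // x cx.
  by apply: contrapT => /negP Ix; apply: nor; exists x.
exists r => // a ca.
(* The weak content identity compares radicals only, so [r * a] enters with exponent 1. *)
have : radical (ideal_mul (content phi f) (content phi g)) (r * a).
  by exists 1%N; rewrite // expr1 mulrC; apply: ideal_mul_mem.
rewrite -wc => /(radical_subset (content_min fg)).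
by rewrite Irad.
Qed.

(** This passes to prime ideals both from radical ideals and from all ideals. *)
Lemma residually_mccoy_sub (P Q : set (ideal R)) : P `<=` Q ->
  residually_mccoy_for phi Q -> residually_mccoy_for phi P.
Proof. by move=> PQ [OR mc]; split=> // I /PQ /mc. Qed.

Lemma mccoy_prime_weak_content :
  residually_mccoy_for phi (@is_prime R) -> weak_content phi.
Proof.
move=> [OR mc]; split=> // f g; apply/seteqP; split.
  exact: radical_subset (content_mul OR).
move=> x [n _ cx]; apply: mem_radical_primes => P Pp cP.
(* With [x ^+ n] in place of [x], only the products generating [c(f)c(g)] need checking. *)
apply: (prime_exp Pp (n := n)).
apply: ideal_gen_min cx => _ [a [b [ca cb ->]]].
have [gP|gP] := boolP (g \in ideal_ext phi P).
  by apply: ideal_absorb; apply: content_min gP _ cb.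
have fgP : f * g \in ideal_ext phi P by apply/ohm_rush_ext.
have /(mccoy_quotP _ OR) mcP := mc P Pp.
have [r Pr rf] := mcP f g fgP gP.
have /(proj2 Pp)[rP|aP] := rf a ca; first by rewrite rP in Pr.
exact: ideal_absorbr.
Qed.

End WeakContent.

Theorem theorem2 (R S : comPzRingType) (phi : {rmorphism R -> S}) :
  (ohm_rush phi ->
     [<-> weak_content phi;
          residually_mccoy_for phi (@is_prime R);
          residually_mccoy_for phi (@is_radical R)])
  /\ (residually_mccoy phi -> weak_content phi).
Proof.
have radical_prime := @residually_mccoy_sub R S phi _ _ (@prime_radical R).
split=> [_|mc].
  tfae.
  - by move=> /weak_content_radical /radical_prime.
  (* From primes to radical ideals the route is through weak content. *)
  - by move=> /mccoy_prime_weak_content /weak_content_radical.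
  - by move=> /radical_prime /mccoy_prime_weak_content.
by apply: mccoy_prime_weak_content; apply: residually_mccoy_sub mc.
Qed.
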